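(* The Hilbert operator $H$ maps the Banach space $\mathcal{W}_0$ onto itself. On $\mathcal{W}_0$ it is an isometric operator. Every function $w(x)=\sum_{n}c_ne^{inx}$ in $\mathcal{W}_0$ such that either $c_n=0$ for all $n>0$ or $c_n=0$ for all $n<0$ is an eigenfunction of $H$. Every function in $\mathcal{W}_0$ can be represented as a sum of two eigenfunctions of $H$.
   Context: $\mathcal{W}$ is the Wiener algebra of functions $w(x)=\sum_{n=-\infty}^\infty c_ne^{inx}$ with norm $\|w\|=\sum_n|c_n|<\infty$; $\mathcal{W}_0$ is the subspace of those $w\in\mathcal{W}$ with $c_0=0$. The Hilbert operator on $2\pi$-periodic functions is $$(Hw)(x)=\mathrm{V.P.}\frac{1}{2\pi}\int_0^{2\pi}\cot\frac{x-y}{2}\,w(y)\,dy,$$ the principal value being taken at the singularity $y=x$ (mod $2\pi$). An eigenfunction of $H$ is a function $w$ with $Hw=\lambda w$ for some constant $\lambda\in\mathbb{C}$ (the zero function is allowed). *)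

(* Defs.v *)
From Stdlib Require Import Reals ZArith ClassicalEpsilon.
From Coquelicot Require Import Coquelicot.

Open Scope R_scope.

(* [cis t] is exp (i t). *)
Definition cis (t : R) : C := (cos t, sin t).

(* Sum of a two-sided series: both one-sided series converge. *)
Definition is_bilateral_series {K : AbsRing} {V : NormedModule K}
    (a : Z -> V) (s : V) : Prop :=
  exists s1 s2 : V,
    is_series (fun n : nat => a (Z.of_nat n)) s1 /\
    is_series (fun n : nat => a (- Z.of_nat (S n))%Z) s2 /\
    s = plus s1 s2.

Definition wiener_expansion (c : Z -> C) (w : R -> C) : Prop :=
  (exists r : R, is_bilateral_series (fun n : Z => Cmod (c n)) r) /\
  forall x : R,
    is_bilateral_series (fun n : Z => (c n * cis (IZR n * x))%C) (w x).

Definition wiener (w : R -> C) : Prop :=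
  exists c : Z -> C, wiener_expansion c w.

Definition wiener0 (w : R -> C) : Prop :=
  exists c : Z -> C, wiener_expansion c w /\ c 0%Z = RtoC 0.

(* The coefficients of an absolutely convergent expansion are unique, so for
   [w] in the Wiener algebra exactly one [r] has the described property. *)
Definition wiener_norm (w : R -> C) : R :=
  iota (fun r : R => exists c : Z -> C,
    wiener_expansion c w /\
    is_bilateral_series (fun n : Z => Cmod (c n)) r).

Definition cot (t : R) : R := cos t / sin t.

(* The kernel cut off at distance [eps] from the singularities
   y = x (mod 2 pi). *)
Definition truncated_integrand (w : R -> C) (x eps y : R) : C :=
  if excluded_middle_informative
       (forall k : Z, eps <= Rabs (x - y - 2 * PI * IZR k))
  then (RtoC (cot ((x - y) / 2)) * w y)%C
  else RtoC 0.

(* Includes the integrability of the truncated integrand for small [eps]. *)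
Definition is_hilbert (w : R -> C) (x : R) (l : C) : Prop :=
  filterlimi
    (fun (eps : R) (z : C) => exists I : C,
       is_RInt (V := C_R_NormedModule) (truncated_integrand w x eps)
         0 (2 * PI) I /\
       z = (RtoC (/ (2 * PI)) * I)%C)
    (at_right 0) (locally l).

Definition hilbert_defined (w : R -> C) : Prop :=
  forall x : R, exists l : C, is_hilbert w x l.

(* The principal value where it exists; always to be read together with
   [hilbert_defined]. *)
Definition hilbert (w : R -> C) (x : R) : C :=
  iota (T := C_CompleteNormedModule) (is_hilbert w x).

Definition eigenfunction (w : R -> C) : Prop :=
  (forall x : R, w (x + 2 * PI) = w x) /\
  hilbert_defined w /\
  exists lambda : C, forall x : R, hilbert w x = (lambda * w x)%C.

(* Main.v *)
Require Import Defs.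
From Stdlib Require Import Reals ZArith Lra Lia ClassicalEpsilon.
From Coquelicot Require Import Coquelicot.

(** Substituting [y = x -+ s] turns the truncated integral of the harmonic
    [e_n] into [e_n x] times the integral of [-2 i cot (s/2) sin (n s)] over
    [eps, pi], which has an elementary primitive [G] with [G 0 = 0] and
    [G pi = pi] (for n > 0).  The functions [G] are bounded on [0, pi]
    uniformly in [n], so dominated convergence lets [eps -> 0] inside the
    absolutely convergent expansion: [H] multiplies [c_n] by [- i sgn n].
    On mean-zero functions this multiplier is unimodular and squares to [-1],
    which yields surjectivity, isometry and the eigenspaces [(w +- i H w) / 2].
    Uniqueness of the mean [c_0] suffices for the isometry: the coefficient
    sequences expanding [w] and [H w] then correspond to each other. *)

(** * The primitive of cot (t/2) sin (n t) *)

(** A function of the Wiener algebra is continuous but has no prescribed modulus of continuity, so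
    the existence of the principal value cannot be read off near y = x; it has to come from a bound
    on the truncated symbols that is uniform in both the frequency and [eps]. With m = n + 1, G t =
    t + 2 sum_{k<m} sin (kt) / k + sin (mt) / m is a primitive of the modified Dirichlet kernel 1 +
    2 sum_{k<m} cos (kt) + cos (mt). Estimating it term by term gives only a harmonic sum of order
    log m. The uniform bound comes from comparing G with a function at distance at most 2 from it
    whose derivative is the nonnegative Fejer kernel. Two limits must be kept apart. For fixed [eps]
    the cut-off kernel is bounded by 1 / sin ([eps] / 2), so uniform convergence of the expansion
    permits termwise integration. This bound blows up as [eps] tends to 0, so the second limit is
    taken in the integrated series, with majorant 3 |c_n|. *)

(* Index [n] stands for the frequency [n + 1]. *)
Fixpoint cot_sin_primitive (n : nat) (t : R) : R :=
  match n with
  | O => t + sin t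
  | S p => cot_sin_primitive p t + sin (INR (S p) * t) / INR (S p)
           + sin (INR (S (S p)) * t) / INR (S (S p))
  end.

Lemma cot_sin_primitive_S (n : nat) (t : R) :
  cot_sin_primitive (S n) t =
  cot_sin_primitive n t + sin (INR (S n) * t) / INR (S n)
  + sin (INR (S (S n)) * t) / INR (S (S n)).
Proof. reflexivity. Qed.

Lemma sin_half_pos (t : R) : 0 < t < 2 * PI -> 0 < sin (t / 2).
Proof. intros H; apply sin_gt_0; lra. Qed.

(** The induction rests on cot (t/2) (sin (bt) - sin (at)) = cos (at) + cos (bt) for b = a + 1:
    raising the frequency by one adds exactly the derivatives of the two new sine terms. *)
Lemma is_derive_cot_sin_primitive (n : nat) (t : R) :
  0 < t < 2 * PI ->
  is_derive (cot_sin_primitive n) t (cot (t / 2) * sin (INR (S n) * t)).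
Proof.
  intros Ht.
  pose proof (sin_half_pos t Ht) as Hs.
  induction n as [|n IH].
  - simpl cot_sin_primitive. auto_derive; [easy|].
    unfold cot. simpl INR. rewrite (Rmult_1_l t).
    replace (sin t) with (2 * sin (t / 2) * cos (t / 2))
      by (rewrite <- sin_2a; f_equal; lra).
    replace (cos t) with (2 * cos (t / 2) * cos (t / 2) - 1)
      by (rewrite <- cos_2a_cos; f_equal; lra).
    field. lra.
  - assert (H1 : INR (S n) <> 0) by (apply not_0_INR; lia).
    assert (H2 : INR (S (S n)) <> 0) by (apply not_0_INR; lia).
    apply (is_derive_ext (fun t => cot_sin_primitive n t +
      (sin (INR (S n) * t) / INR (S n) + sin (INR (S (S n)) * t) / INR (S (S n))))).
    { intros s. rewrite cot_sin_primitive_S. symmetry. apply Rplus_assoc. }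
    set (a := INR (S n)) in *. set (b := INR (S (S n))) in *.
    assert (Hab : b = a + 1) by (unfold a, b; rewrite (S_INR (S n)); lra).
    replace (cot (t / 2) * sin (b * t)) with
      (plus (cot (t / 2) * sin (a * t)) (cos (a * t) + cos (b * t))).
    { apply @is_derive_plus. exact IH.
      auto_derive; [easy|]. field. auto. }
    unfold plus; simpl. unfold cot.
    assert (E : b * t = a * t + 2 * (t / 2)) by (rewrite Hab; lra).
    rewrite E, sin_plus, cos_plus, sin_2a, cos_2a.
    pose proof (sin2_cos2 (t / 2)) as Q. unfold Rsqr in Q.
    set (s := sin (t / 2)) in *. set (c := cos (t / 2)) in *.
    field_simplify; [|lra|lra]. f_equal.
    replace (c ^ 3) with (c * (1 - s * s)) by (rewrite <- Q; ring).
    replace (c ^ 2) with (1 - s * s) by (rewrite <- Q; ring).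
    ring.
Qed.

Lemma sin_INR_PI (n : nat) : sin (INR n * PI) = 0.
Proof.
  induction n as [|n IH]; [rewrite Rmult_0_l; exact sin_0|].
  rewrite S_INR, Rmult_plus_distr_r, sin_plus, IH, Rmult_1_l, sin_PI; ring.
Qed.

Lemma cot_sin_primitive_PI (n : nat) : cot_sin_primitive n PI = PI.
Proof.
  induction n as [|n IH].
  - simpl. rewrite sin_PI; ring.
  - rewrite cot_sin_primitive_S, !sin_INR_PI, IH. unfold Rdiv; ring.
Qed.

(** * Bounds on the primitive, linear near 0 and uniform in the frequency *)

Lemma Rabs_sin_le (x : R) : 0 <= x -> Rabs (sin x) <= x.
Proof.
  intros Hx. destruct (Req_dec x 0) as [->|H0].
  { rewrite sin_0, Rabs_R0; lra. }
  destruct (Rle_dec x 1) as [H1|H1].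
  - rewrite Rabs_pos_eq.
    + apply Rlt_le, sin_lt_x; lra.
    + apply sin_ge_0; [lra|]. pose proof PI_4; pose proof PI2_1; lra.
  - apply Rle_trans with 1; [|lra].
    apply Rabs_le. pose proof (SIN_bound x); lra.
Qed.

Lemma Rabs_sin_div_le (k : nat) (t : R) :
  0 <= t -> Rabs (sin (INR (S k) * t) / INR (S k)) <= t.
Proof.
  intros Ht.
  assert (Hk : 0 < INR (S k)) by (apply lt_0_INR; lia).
  unfold Rdiv. rewrite Rabs_mult, (Rabs_pos_eq (/ _)) by (left; apply Rinv_0_lt_compat; lra).
  apply Rmult_le_reg_r with (INR (S k)); [lra|].
  rewrite Rmult_assoc, Rinv_l by lra. rewrite Rmult_1_r, (Rmult_comm t).
  apply Rabs_sin_le. nra.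
Qed.

(** The primitive consists of 2 (n + 1) terms, counted with multiplicity, each at most [t] in
    absolute value. The bound depends on [n] but vanishes at 0, which is what the limit of each
    single symbol requires. *)
Lemma cot_sin_primitive_linear_bound (n : nat) (t : R) :
  0 <= t -> Rabs (cot_sin_primitive n t) <= 2 * INR (S n) * t.
Proof.
  intros Ht. induction n as [|n IH].
  - simpl. apply Rle_trans with (1 := Rabs_triang _ _).
    rewrite (Rabs_pos_eq t) by lra. pose proof (Rabs_sin_le t Ht). simpl; lra.
  - rewrite cot_sin_primitive_S, (S_INR (S n)).
    apply Rle_trans with (1 := Rabs_triang _ _).
    pose proof (Rabs_sin_div_le (S n) t Ht) as H1. rewrite (S_INR (S n)) in H1.
    pose proof (Rabs_sin_div_le n t Ht).
    pose proof (Rabs_triang (cot_sin_primitive n t) (sin (INR (S n) * t) / INR (S n))).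
    nra.
Qed.

(** Where sin x > 0 this says x cot x <= 1, which keeps the corrector bounded near 0. The function
    sin x - x cos x vanishes at 0 and has derivative x sin x >= 0. *)
Lemma mult_cos_le_sin (x : R) : 0 <= x <= PI -> x * cos x <= sin x.
Proof.
  intros Hx.
  destruct (MVT_gen (fun x => sin x - x * cos x) 0 x (fun x => x * sin x))
    as [c [Hc E]].
  - intros y _. auto_derive; [easy|]. ring.
  - intros y _. apply derivable_continuous_pt.
    apply ex_derive_Reals_0. auto_derive; easy.
  - rewrite Rmin_left, Rmax_right in Hc by lra.
    rewrite sin_0 in E.
    assert (0 <= sin c) by (apply sin_ge_0; lra).
    assert (0 <= c * sin c) by nra. nra.
Qed.

Lemma one_minus_cos_le (x : R) : 0 <= x -> 1 - cos x <= x.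
Proof.
  intros Hx.
  replace x with (2 * (x / 2)) at 1 by lra.
  rewrite cos_2a_sin.
  pose proof (Rabs_sin_le (x / 2) ltac:(lra)) as H.
  pose proof (SIN_bound (x / 2)).
  apply Rabs_le_between in H. nra.
Qed.

(* The derivative (1 - cos mt) / (2m sin^2 (t/2)) (m = n + 1) of this
   function is nonnegative: the two oscillating terms cot (t/2) sin mt cancel. *)
Definition monotone_corrector (n : nat) (t : R) : R :=
  cot_sin_primitive n t + cot (t / 2) * (cos (INR (S n) * t) - 1) / INR (S n).

(** Since 1 - cos (mt) = 2 sin^2 (mt/2), the derivative is the Fejer kernel sin^2 (mt/2) / (m sin^2
    (t/2)). *)
Lemma monotone_corrector_incr (n : nat) (s t : R) :
  0 < s <= t -> t <= PI -> monotone_corrector n s <= monotone_corrector n t.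
Proof.
  intros Hs Ht.
  assert (Hk : 0 < INR (S n)) by (apply lt_0_INR; lia).
  set (m := INR (S n)) in *.
  assert (D : forall x, 0 < x < 2 * PI -> is_derive (monotone_corrector n) x
    ((1 - cos (m * x)) / (2 * m * (sin (x / 2)) ^ 2))).
  { intros x Hx. pose proof (sin_half_pos x Hx) as Hsp.
    replace ((1 - cos (m * x)) / (2 * m * sin (x / 2) ^ 2)) with
      (plus (cot (x / 2) * sin (m * x))
        ((1 - cos (m * x)) / (2 * m * sin (x / 2) ^ 2) - cot (x / 2) * sin (m * x)))
      by (unfold plus; simpl; ring).
    apply @is_derive_plus.
    - apply is_derive_cot_sin_primitive; exact Hx.
    - fold m. unfold cot. auto_derive; [repeat split; lra|].
      pose proof (sin2_cos2 (x / 2)) as Q. unfold Rsqr in Q.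
      change (x * / 2) with (x / 2).
      set (S := sin (x / 2)) in *. set (c := cos (x / 2)) in *.
      field_simplify; [|lra|lra]. f_equal.
      replace (c ^ 2) with (1 - S * S) by (rewrite <- Q; ring). ring. }
  destruct (MVT_gen (monotone_corrector n) s t
     (fun x => (1 - cos (m * x)) / (2 * m * (sin (x / 2)) ^ 2))) as [c [Hc E]].
  - intros x. rewrite Rmin_left, Rmax_right by lra. intros Hx. apply D; lra.
  - intros x. rewrite Rmin_left, Rmax_right by lra. intros Hx.
    apply derivable_continuous_pt, ex_derive_Reals_0. eexists. apply D; lra.
  - rewrite Rmin_left, Rmax_right in Hc by lra.
    assert (0 <= (1 - cos (m * c)) / (2 * m * (sin (c / 2)) ^ 2)).
    { apply Rdiv_le_0_compat. pose proof (COS_bound (m * c)); lra.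
      pose proof (sin_half_pos c ltac:(lra)). apply Rmult_lt_0_compat; [lra|].
      apply pow_lt; lra. }
    nra.
Qed.

(** The added term lies between -2 and 0: with m = n + 1, 1 - cos (mt) <= mt absorbs the division by
    m, and t cot (t/2) <= 2 absorbs the singularity. *)
Lemma corrector_bound (n : nat) (t : R) :
  0 < t <= PI ->
  cot_sin_primitive n t - 2 <= monotone_corrector n t <= cot_sin_primitive n t.
Proof.
  intros Ht. unfold monotone_corrector.
  assert (Hk : 0 < INR (S n)) by (apply lt_0_INR; lia).
  set (m := INR (S n)) in *.
  pose proof (sin_half_pos t ltac:(lra)) as Hs.
  pose proof (mult_cos_le_sin (t / 2) ltac:(lra)) as Hc.
  pose proof (cos_ge_0 (t / 2) ltac:(lra) ltac:(lra)) as Hc0.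
  pose proof (one_minus_cos_le (m * t) ltac:(nra)) as H1.
  pose proof (COS_bound (m * t)) as H2.
  assert (H3 : 0 <= cot (t / 2)) by (apply Rdiv_le_0_compat; lra).
  assert (H4 : cot (t / 2) * t <= 2).
  { unfold cot. apply Rmult_le_reg_r with (sin (t / 2)); [lra|].
    field_simplify; [|lra]. nra. }
  set (k := cot (t / 2)) in *. set (C := cos (m * t)) in *.
  assert (H5 : 0 <= k * (1 - C)) by nra.
  assert (H6 : k * (1 - C) <= 2 * m) by nra.
  assert (H7 : k * (1 - C) / m <= 2).
  { apply Rmult_le_reg_r with m; [lra|]. field_simplify; lra. }
  assert (H8 : 0 <= k * (1 - C) / m) by (apply Rdiv_le_0_compat; lra).
  replace (k * (C - 1) / m) with (- (k * (1 - C) / m)) by (field; lra).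
  lra.
Qed.

(** Above, monotonicity up to PI gives G t <= G PI + 2 = PI + 2 <= 6. Below, monotonicity from a
    point [s] <= [t] gives G t >= G s - 2 >= -4. *)
Lemma cot_sin_primitive_bound (n : nat) (t : R) :
  0 < t <= PI -> Rabs (cot_sin_primitive n t) <= 6.
Proof.
  intros Ht.
  assert (Hk : 0 < INR (S n)) by (apply lt_0_INR; lia).
  pose proof PI_4 as Hpi.
  pose proof (corrector_bound n t Ht) as B.
  pose proof (monotone_corrector_incr n t PI ltac:(lra) ltac:(lra)) as U.
  pose proof (corrector_bound n PI ltac:(lra)) as BP.
  rewrite cot_sin_primitive_PI in BP.
  (* At the scale 1 / (n + 1) the linear bound is still at most 2, whatever the frequency;
     monotonicity covers the rest of the interval. *)
  set (s := Rmin t (/ INR (S n))).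
  assert (Hs : 0 < s <= t).
  { unfold s. split; [|apply Rmin_l]. apply Rmin_glb_lt; [lra|].
    apply Rinv_0_lt_compat; lra. }
  pose proof (monotone_corrector_incr n s t Hs ltac:(lra)) as L.
  pose proof (corrector_bound n s ltac:(lra)) as Bs.
  pose proof (cot_sin_primitive_linear_bound n s ltac:(lra)) as Ls.
  assert (H1 : INR (S n) * s <= 1).
  { rewrite <- (Rinv_r (INR (S n))) by lra. apply Rmult_le_compat_l; [lra|].
    apply Rmin_r. }
  apply Rabs_le_between in Ls.
  apply Rabs_le. lra.
Qed.

(** * Truncated integrals of periodic functions *)

Lemma scal_1_R {V : NormedModule R_AbsRing} (x : V) : scal 1 x = x.
Proof. exact (scal_one (K := R_AbsRing) x). Qed.

Lemma scal_neg1_R {V : NormedModule R_AbsRing} (x : V) : scal (-1) x = opp x.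
Proof. exact (scal_opp_one (K := R_AbsRing) x). Qed.

Lemma is_RInt_translate {V : NormedModule R_AbsRing} (f : R -> V) (v a b : R) (l : V) :
  is_RInt f a b l -> is_RInt (fun y => f (y - v)) (v + a) (v + b) l.
Proof.
  intros H.
  apply (is_RInt_ext (fun y => scal 1 (f (1 * y + - v)))).
  - intros y _. rewrite Rmult_1_l. apply scal_1_R.
  - apply is_RInt_comp_lin.
    replace (1 * (v + a) + - v) with a by ring.
    replace (1 * (v + b) + - v) with b by ring. exact H.
Qed.

Lemma is_RInt_reflect {V : NormedModule R_AbsRing} (f : R -> V) (v a b : R) (l : V) :
  is_RInt f a b l -> is_RInt (fun y => f (v - y)) (v - b) (v - a) l.
Proof.
  intros H. rewrite <- (opp_opp l).
  apply (is_RInt_ext (fun y => opp (scal (-1) (f ((-1) * y + v))))).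
  - intros y _. rewrite scal_neg1_R, opp_opp. f_equal; ring.
  - apply @is_RInt_opp, is_RInt_comp_lin.
    replace (-1 * (v - b) + v) with b by ring.
    replace (-1 * (v - a) + v) with a by ring.
    apply is_RInt_swap, H.
Qed.

Lemma periodic_IZR {A : Type} (f : R -> A) (T : R) :
  (forall y, f (y + T) = f y) -> forall (k : Z) (y : R), f (y + IZR k * T) = f y.
Proof.
  intros Hf k.
  induction k as [|k IH|k IH] using Z.peano_ind; intros y.
  - f_equal; ring.
  - rewrite succ_IZR, <- (IH y), <- (Hf (y + IZR k * T)). f_equal; ring.
  - unfold Z.pred; rewrite plus_IZR, <- (IH y), <- (Hf (y + (IZR k + -1) * T)). f_equal; ring.
Qed.

Lemma exists_period_shift (T y : R) :
  0 < T -> exists k : Z, 0 <= y + IZR k * T < T.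
Proof.
  intros HT. destruct (archimed (y / T)) as [H1 H2].
  exists (1 - up (y / T))%Z. rewrite minus_IZR.
  assert (E : y = y / T * T) by (field; lra).
  rewrite E at 1 3. nra.
Qed.

(** The principal value is defined over [0, 2 PI], while the symmetry of the kernel is visible on a
    window centred at the singularity; this lemma links the two. *)
Lemma is_RInt_period {V : CompleteNormedModule R_AbsRing} (f : R -> V) (T b : R) (l : V) :
  0 < T -> (forall y, f (y + T) = f y) ->
  is_RInt f b (b + T) l -> is_RInt f 0 T l.
Proof.
  intros HT Hf H.
  destruct (exists_period_shift T b HT) as [k Hk].
  apply (is_RInt_translate f (IZR k * T)) in H.
  apply (is_RInt_ext _ f) in H.
  2:{ intros y _. rewrite <- (periodic_IZR f T Hf k (y - _)). f_equal; ring. }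
  replace (IZR k * T + (b + T)) with (b + IZR k * T + T) in H by ring.
  rewrite (Rplus_comm (IZR k * T)) in H.
  set (c := b + IZR k * T) in *.
  assert (E : ex_RInt f c (c + T)) by (exists l; exact H).
  (* The window now starts at [c] in [0, T). Its overhang beyond [T], moved back by one period, is
     the missing piece from 0 to [c]. *)
  destruct (ex_RInt_Chasles_1 f c T (c + T) ltac:(lra) E) as [l1 H1].
  destruct (ex_RInt_Chasles_2 f c T (c + T) ltac:(lra) E) as [l2 H2].
  pose proof (is_RInt_Chasles _ _ _ _ _ _ H1 H2) as H3.
  assert (H4 : is_RInt f 0 c l2).
  { apply (is_RInt_translate f (- T)) in H2.
    replace (- T + T) with 0 in H2 by ring.
    replace (- T + (c + T)) with c in H2 by ring.
    refine (is_RInt_ext _ _ _ _ _ _ H2).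
    intros y _. rewrite <- (Hf y). f_equal; ring. }
  replace l with (plus l2 l1).
  - exact (is_RInt_Chasles _ _ _ _ _ _ H4 H1).
  - rewrite plus_comm, <- (is_RInt_unique _ _ _ _ H3). apply is_RInt_unique, H.
Qed.

Lemma cot_plus_PI (t : R) : cot (t + PI) = cot t.
Proof.
  unfold cot. rewrite neg_sin, neg_cos.
  unfold Rdiv. rewrite Rinv_opp. ring.
Qed.

Lemma cot_opp (t : R) : cot (- t) = - cot t.
Proof. unfold cot. rewrite cos_neg, sin_neg. unfold Rdiv. rewrite Rinv_opp. ring. Qed.

Lemma far_from_period_shift (eps t v : R) (j : Z) :
  v = 2 * PI * IZR j ->
  (forall k : Z, eps <= Rabs (t - 2 * PI * IZR k)) ->
  forall k : Z, eps <= Rabs (t + v - 2 * PI * IZR k).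
Proof.
  intros -> H k. specialize (H (k - j)%Z). rewrite minus_IZR in H.
  eapply Rle_trans; [exact H|]. right. f_equal. ring.
Qed.

Lemma far_from_period (eps t : R) :
  eps <= t <= 2 * PI - eps -> forall k : Z, eps <= Rabs (t - 2 * PI * IZR k).
Proof.
  intros Ht k. pose proof PI_RGT_0.
  destruct (Rle_dec eps 0); [apply Rle_trans with 0; [lra|apply Rabs_pos]|].
  destruct (Z_le_gt_dec k 0) as [Hk|Hk].
  - apply IZR_le in Hk.
    assert (2 * PI * IZR k <= 2 * PI * 0) by (apply Rmult_le_compat_l; lra).
    rewrite Rabs_pos_eq; lra.
  - assert (Hk' : (1 <= k)%Z) by lia. apply IZR_le in Hk'.
    assert (2 * PI * 1 <= 2 * PI * IZR k) by (apply Rmult_le_compat_l; lra).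
    rewrite Rabs_left1; lra.
Qed.

Lemma truncated_integrand_periodic (w : R -> C) (x eps y : R) :
  (forall t, w (t + 2 * PI) = w t) ->
  truncated_integrand w x eps (y + 2 * PI) = truncated_integrand w x eps y.
Proof.
  intros Hw. unfold truncated_integrand.
  assert (S : forall a v j, v = 2 * PI * IZR j ->
    (forall k : Z, eps <= Rabs (x - a - 2 * PI * IZR k)) ->
    forall k : Z, eps <= Rabs (x - (a - v) - 2 * PI * IZR k)).
  { intros a v j Hv H. replace (x - (a - v)) with (x - a + v) by ring.
    eapply far_from_period_shift; eassumption. }
  destruct excluded_middle_informative as [?|n];
    destruct excluded_middle_informative as [?|n'].
  - rewrite Hw. f_equal. f_equal.
    rewrite <- (cot_plus_PI ((x - (y + 2 * PI)) / 2)). f_equal. field.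
  - contradict n'. replace y with (y + 2 * PI - 2 * PI) by ring.
    apply S with 1%Z; [ring|assumption].
  - contradict n. replace (y + 2 * PI) with (y - - (2 * PI)) by ring.
    apply S with (-1)%Z; [ring|assumption].
  - reflexivity.
Qed.

Lemma truncated_integrand_far (w : R -> C) (x eps y : R) :
  eps <= x - y <= 2 * PI - eps \/ eps <= y - x <= 2 * PI - eps ->
  truncated_integrand w x eps y = (RtoC (cot ((x - y) / 2)) * w y)%C.
Proof.
  intros H. unfold truncated_integrand.
  destruct excluded_middle_informative as [?|n]; [reflexivity|].
  contradict n. intros k. destruct H as [H|H].
  - apply far_from_period; exact H.
  - pose proof (far_from_period _ _ H (- k)%Z) as F. rewrite opp_IZR in F.
    rewrite <- Rabs_Ropp. eapply Rle_trans; [exact F|]. right; f_equal; ring.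
Qed.

Lemma truncated_integrand_near (w : R -> C) (x eps y : R) :
  Rabs (x - y) < eps -> truncated_integrand w x eps y = RtoC 0.
Proof.
  intros H. unfold truncated_integrand.
  destruct excluded_middle_informative as [F|?]; [|reflexivity].
  specialize (F 0%Z). replace (x - y - 2 * PI * 0) with (x - y) in F by ring. lra.
Qed.

(** On the window from x - PI to x + PI only the singularity y = x matters. The cut-off removes the
    middle piece, and oddness of cot produces the minus sign of [J]. *)
Lemma is_RInt_truncated_integrand (w : R -> C) (x eps : R) (I J : C) :
  (forall t, w (t + 2 * PI) = w t) -> 0 < eps < PI ->
  is_RInt (V := C_R_NormedModule)
    (fun s => RtoC (cot (s / 2)) * w (x - s)%R)%C eps PI I ->
  is_RInt (V := C_R_NormedModule)
    (fun s => RtoC (cot (s / 2)) * w (x + s)%R)%C eps PI J ->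
  is_RInt (V := C_R_NormedModule) (truncated_integrand w x eps) 0 (2 * PI) (I - J)%C.
Proof.
  intros Hw He HI HJ.
  apply (is_RInt_period (V := C_R_CompleteNormedModule)) with (b := x - PI).
  { lra. }
  { intros y. apply truncated_integrand_periodic, Hw. }
  replace (x - PI + 2 * PI) with (x + PI) by ring.
  replace (I - J)%C with (plus (plus (I : C_R_NormedModule) zero) (opp (J : C_R_NormedModule)))
    by (rewrite plus_zero_r; reflexivity).
  apply @is_RInt_Chasles with (x + eps); [apply @is_RInt_Chasles with (x - eps)|].
  - refine (is_RInt_ext (V := C_R_NormedModule) _ _ _ _ _ _
      (is_RInt_reflect (V := C_R_NormedModule) _ x _ _ _ HI)).
    intros y. rewrite Rmin_left, Rmax_right by lra. intros Hy.
    rewrite truncated_integrand_far by (left; lra).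
    replace (x - (x - y)) with y by ring. reflexivity.
  - apply (is_RInt_ext (V := C_R_NormedModule) (fun _ => zero)).
    { intros y. rewrite Rmin_left, Rmax_right by lra. intros Hy.
      rewrite truncated_integrand_near; [reflexivity|]. apply Rabs_lt_between. lra. }
    pose proof (is_RInt_const (V := C_R_NormedModule) (x - eps) (x + eps) zero) as Z.
    rewrite (scal_zero_r (V := C_R_NormedModule)) in Z. exact Z.
  - refine (is_RInt_ext (V := C_R_NormedModule) _ _ _ _ _ _
      (is_RInt_opp (V := C_R_NormedModule) _ _ _ _
        (is_RInt_translate (V := C_R_NormedModule) _ x _ _ _ HJ))).
    intros y. rewrite Rmin_left, Rmax_right by lra. intros Hy.
    rewrite truncated_integrand_far by (right; lra).
    replace (x + (y - x)) with y by ring.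
    replace ((x - y) / 2) with (- ((y - x) / 2)) by field.
    rewrite cot_opp, RtoC_opp.
    change ((- (cot ((y - x) / 2) * w y))%C = (- cot ((y - x) / 2) * w y)%C).
    ring.
Qed.

(** * Harmonics *)

Lemma cis_plus (a b : R) : cis (a + b) = (cis a * cis b)%C.
Proof.
  unfold cis, Cmult; simpl. rewrite cos_plus, sin_plus. f_equal; ring.
Qed.

Lemma Cmod_cis (t : R) : Cmod (cis t) = 1.
Proof.
  unfold Cmod, cis; simpl. rewrite !Rmult_1_r.
  rewrite Rplus_comm. fold (Rsqr (sin t)) (Rsqr (cos t)). rewrite sin2_cos2. apply sqrt_1.
Qed.

Lemma cis_2PI : cis (2 * PI) = RtoC 1.
Proof. unfold cis. rewrite cos_2PI, sin_2PI. reflexivity. Qed.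

Lemma cis_IZR_period (n : Z) (t : R) : cis (IZR n * (t + 2 * PI)) = cis (IZR n * t).
Proof.
  rewrite Rmult_plus_distr_l. revert n.
  assert (H : forall t, cis (t + 2 * PI) = cis t).
  { intros s. rewrite cis_plus, cis_2PI. ring. }
  intros n. apply (periodic_IZR cis (2 * PI) H).
Qed.

Lemma is_RInt_mult_RtoC (z : C) (g : R -> R) (a b l : R) :
  is_RInt g a b l ->
  is_RInt (V := C_R_NormedModule) (fun s => (z * RtoC (g s))%C) a b (z * RtoC l)%C.
Proof.
  intros H. destruct z as [p q].
  assert (E : forall r : R, ((p, q) * RtoC r)%C = (p * r, q * r)).
  { intros r. unfold Cmult, RtoC; simpl. f_equal; ring. }
  rewrite E.
  apply (is_RInt_ext (V := C_R_NormedModule) (fun s => (p * g s, q * g s))).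
  { intros s _. symmetry; apply E. }
  apply (is_RInt_fct_extend_pair (U := R_NormedModule) (V := R_NormedModule)); simpl;
    apply (is_RInt_scal (V := R_NormedModule)); exact H.
Qed.

(** Used with [b] = -1 and [b] = 1 for the two sides of the singularity. Existence suffices for each
    side: the cosine parts cancel in the difference, and only the sine part is evaluated. *)
Lemma ex_RInt_cot_cis (n : Z) (a b eps : R) :
  0 < eps < PI ->
  ex_RInt (V := C_R_NormedModule)
    (fun s => RtoC (cot (s / 2)) * cis (IZR n * (a + b * s)))%C eps PI.
Proof.
  intros He.
  assert (H : forall phi : R -> R, (forall x, ex_derive phi x) ->
    ex_RInt (fun s => cot (s / 2) * phi (IZR n * (a + b * s))) eps PI).
  { intros phi Hphi. apply (ex_RInt_continuous (V := R_CompleteNormedModule)).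
    intros s. rewrite Rmin_left, Rmax_right by lra. intros Hs.
    apply @ex_derive_continuous. unfold cot.
    pose proof (sin_half_pos s ltac:(lra)).
    auto_derive. repeat split; [apply Rgt_not_eq; assumption | apply Hphi]. }
  destruct (H cos) as [l1 H1]. { intros x; auto_derive; easy. }
  destruct (H sin) as [l2 H2]. { intros x; auto_derive; easy. }
  exists (l1, l2).
  apply (is_RInt_ext (V := C_R_NormedModule)
    (fun s => (cot (s / 2) * cos (IZR n * (a + b * s)), cot (s / 2) * sin (IZR n * (a + b * s))))).
  { intros s _. unfold cis, Cmult, RtoC; simpl. f_equal; ring. }
  apply (is_RInt_fct_extend_pair (U := R_NormedModule) (V := R_NormedModule)); assumption.
Qed.

(* [truncated_symbol n eps] is 1/(2 pi) times the integral of
   cot (t/2) exp (- i n t) over eps <= |t| <= pi. *)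
Definition truncated_symbol (n : Z) (eps : R) : C :=
  (- Ci * RtoC (IZR (Z.sgn n) *
     (1 - cot_sin_primitive (pred (Z.abs_nat n)) eps / PI)))%C.

(** [pred] compensates the shifted index of the primitive. For n = 0 the index defaults to 0, but
    the factor [Z.sgn n] vanishes. *)
Lemma is_RInt_cot_sin (n : Z) (eps : R) :
  0 < eps < PI ->
  is_RInt (fun s => cot (s / 2) * sin (IZR n * s)) eps PI
    (IZR (Z.sgn n) * (PI - cot_sin_primitive (pred (Z.abs_nat n)) eps)).
Proof.
  intros He.
  assert (P : forall m, is_RInt (fun s => cot (s / 2) * sin (INR (S m) * s)) eps PI
    (PI - cot_sin_primitive m eps)).
  { intros m. rewrite <- (cot_sin_primitive_PI m) at 2.
    apply (is_RInt_derive (V := R_CompleteNormedModule)); intros s; rewrite Rmin_left, Rmax_right by lra; intros Hs.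
    - apply is_derive_cot_sin_primitive; lra.
    - apply @ex_derive_continuous. unfold cot.
      pose proof (sin_half_pos s ltac:(lra)).
      auto_derive. apply Rgt_not_eq; assumption. }
  assert (Hn : n = 0%Z \/ exists m, n = Z.of_nat (S m) \/ n = (- Z.of_nat (S m))%Z).
  { destruct (Z.eq_dec n 0) as [|Hn]; [left; assumption|right].
    exists (pred (Z.abs_nat n)). lia. }
  destruct Hn as [->|[m [->| ->]]].
  - simpl Z.sgn. rewrite Rmult_0_l.
    apply (is_RInt_ext (fun _ => 0)).
    { intros s _. rewrite Rmult_0_l, sin_0. symmetry. apply Rmult_0_r. }
    pose proof (is_RInt_const (V := R_NormedModule) eps PI 0) as Z.
    rewrite (scal_zero_r (V := R_NormedModule)) in Z. exact Z.
  - rewrite Zabs2Nat.id, Nat.pred_succ, <- INR_IZR_INZ.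
    replace (Z.sgn (Z.of_nat (S m))) with 1%Z by lia.
    rewrite Rmult_1_l. apply P.
  - replace (Z.abs_nat (- Z.of_nat (S m))) with (S m) by lia.
    replace (Z.sgn (- Z.of_nat (S m))) with (-1)%Z by lia.
    rewrite Nat.pred_succ, opp_IZR, <- INR_IZR_INZ.
    apply (is_RInt_ext (fun s => scal (-1) (cot (s / 2) * sin (INR (S m) * s)))).
    { intros s _. rewrite Ropp_mult_distr_l_reverse, sin_neg.
      unfold scal; simpl; unfold mult; simpl. ring. }
    apply (is_RInt_scal (V := R_NormedModule)), P.
Qed.

Lemma is_RInt_truncated_cis (n : Z) (x eps : R) :
  0 < eps < PI ->
  is_RInt (V := C_R_NormedModule)
    (truncated_integrand (fun y => cis (IZR n * y)) x eps) 0 (2 * PI)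
    (RtoC (2 * PI) * (truncated_symbol n eps * cis (IZR n * x)))%C.
Proof.
  intros He.
  destruct (ex_RInt_cot_cis n x (-1) eps He) as [I HI].
  destruct (ex_RInt_cot_cis n x 1 eps He) as [J HJ].
  replace (RtoC (2 * PI) * (truncated_symbol n eps * cis (IZR n * x)))%C with (I - J)%C.
  - apply is_RInt_truncated_integrand; [intros t; apply cis_IZR_period|exact He| |].
    + refine (is_RInt_ext (V := C_R_NormedModule) _ _ _ _ _ _ HI).
      intros s _. replace (x + -1 * s) with (x - s) by ring. reflexivity.
    + refine (is_RInt_ext (V := C_R_NormedModule) _ _ _ _ _ _ HJ).
      intros s _. replace (x + 1 * s) with (x + s) by ring. reflexivity.
  - pose proof (is_RInt_minus (V := C_R_NormedModule) _ _ _ _ _ _ HI HJ) as H1.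
    pose proof (is_RInt_mult_RtoC (- RtoC 2 * Ci * cis (IZR n * x))%C _ _ _ _
      (is_RInt_cot_sin n eps He)) as H2.
    assert (E : is_RInt (V := C_R_NormedModule) (fun s => minus
        (G := C_R_NormedModule)
        (RtoC (cot (s / 2)) * cis (IZR n * (x + -1 * s)))%C
        (RtoC (cot (s / 2)) * cis (IZR n * (x + 1 * s)))%C) eps PI
       (- RtoC 2 * Ci * cis (IZR n * x) * RtoC (IZR (Z.sgn n) *
        (PI - cot_sin_primitive (pred (Z.abs_nat n)) eps)))%C).
    { refine (is_RInt_ext (V := C_R_NormedModule) _ _ _ _ _ _ H2).
      intros s _.
      change ((- RtoC 2 * Ci * cis (IZR n * x) * RtoC (cot (s / 2) * sin (IZR n * s)))%C =
        (RtoC (cot (s / 2)) * cis (IZR n * (x + -1 * s)) -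
         RtoC (cot (s / 2)) * cis (IZR n * (x + 1 * s)))%C).
      rewrite !Rmult_plus_distr_l, !cis_plus, RtoC_mult.
      replace (IZR n * (-1 * s)) with (- (IZR n * s)) by ring.
      rewrite Rmult_1_l.
      assert (E : (cis (- (IZR n * s)) - cis (IZR n * s))%C
        = (- RtoC 2 * Ci * RtoC (sin (IZR n * s)))%C).
      { unfold cis, Cminus, Cmult, Cplus, Copp, Ci, RtoC; simpl.
        rewrite cos_neg, sin_neg. f_equal; ring. }
      transitivity (RtoC (cot (s / 2)) * cis (IZR n * x) *
        (cis (- (IZR n * s)) - cis (IZR n * s)))%C; [rewrite E|]; ring. }
    apply (is_RInt_unique (V := C_R_CompleteNormedModule)) in H1.
    apply (is_RInt_unique (V := C_R_CompleteNormedModule)) in E.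
    rewrite H1 in E.
    change (I - J)%C with (minus (G := C_R_NormedModule) I J).
    etransitivity; [exact E|].
    unfold truncated_symbol.
    replace (IZR (Z.sgn n) * (PI - cot_sin_primitive (pred (Z.abs_nat n)) eps))
      with (PI * (IZR (Z.sgn n) * (1 - cot_sin_primitive (pred (Z.abs_nat n)) eps / PI)))
      by (field; apply PI_neq0).
    rewrite !RtoC_mult. ring.
Qed.

(** * The limit symbol and the control of the truncated ones *)

Definition hilbert_symbol (n : Z) : C := (- Ci * RtoC (IZR (Z.sgn n)))%C.

Lemma Cmod_Ci : Cmod Ci = 1.
Proof.
  unfold Cmod, Ci; simpl. replace (0 * (0 * 1) + 1 * (1 * 1)) with 1 by ring. apply sqrt_1.
Qed.

Lemma Rabs_IZR_sgn_le (n : Z) : Rabs (IZR (Z.sgn n)) <= 1.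
Proof.
  rewrite <- abs_IZR. apply IZR_le. lia.
Qed.

(** The constant is 1 + 6 / 3, from the bound 6 on the primitive and PI > 3. *)
Lemma Cmod_truncated_symbol_le (n : Z) (eps : R) :
  0 < eps < PI -> Cmod (truncated_symbol n eps) <= 3.
Proof.
  intros He. unfold truncated_symbol.
  rewrite Cmod_mult, Cmod_opp, Cmod_Ci, Rmult_1_l, Cmod_R, Rabs_mult.
  set (G := cot_sin_primitive _ eps).
  pose proof (cot_sin_primitive_bound (pred (Z.abs_nat n)) eps ltac:(lra)) as B.
  fold G in B. apply Rabs_le_between in B.
  pose proof (Rabs_IZR_sgn_le n) as S. pose proof (Rabs_pos (IZR (Z.sgn n))) as S0.
  assert (P3 : 3 < PI) by (pose proof PI2_3_2; lra).
  assert (Q : Rabs (1 - G / PI) <= 3).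
  { assert (E : G = G / PI * PI) by (field; lra).
    set (q := G / PI) in *. apply Rabs_le. nra. }
  nra.
Qed.

Lemma truncated_symbol_limit (n : Z) :
  filterlim (U := C_UniformSpace) (truncated_symbol n) (at_right 0) (locally (hilbert_symbol n)).
Proof.
  apply (filterlim_locally (U := C_UniformSpace)). intros [d Hd].
  set (m := pred (Z.abs_nat n)).
  assert (Hm : 0 < 2 * INR (S m)) by (pose proof (lt_0_INR (S m) ltac:(lia)); lra).
  (* The radius is read off the linear bound on the primitive; it shrinks as the frequency grows, so
     this limit is not uniform in [n]. *)
  assert (Hq : 0 < d / (2 * INR (S m))) by (apply Rdiv_lt_0_compat; assumption).
  exists (mkposreal _ Hq). intros eps Hball Hpos.
  assert (Heps : eps < d / (2 * INR (S m))).
  { change (Rabs (eps - 0) < d / (2 * INR (S m))) in Hball. apply Rabs_lt_between in Hball. lra. }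
  pose proof (cot_sin_primitive_linear_bound m eps ltac:(lra)) as B.
  assert (H : 2 * INR (S m) * eps < d).
  { apply Rmult_lt_compat_l with (r := 2 * INR (S m)) in Heps; [|lra].
    replace (2 * INR (S m) * (d / (2 * INR (S m)))) with d in Heps by (field; lra). exact Heps. }
  simpl. apply (C_NormedModule_mixin_compat1).
  unfold minus, plus, opp; simpl. fold (Cminus (truncated_symbol n eps) (hilbert_symbol n)).
  replace (truncated_symbol n eps - hilbert_symbol n)%C with
    (Ci * RtoC (IZR (Z.sgn n) * (cot_sin_primitive m eps / PI)))%C.
  2:{ unfold truncated_symbol, hilbert_symbol. fold m.
      rewrite !RtoC_mult, RtoC_minus. ring. }
  rewrite Cmod_mult, Cmod_Ci, Rmult_1_l, Cmod_R, Rabs_mult.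
  pose proof (Rabs_IZR_sgn_le n) as S. pose proof (Rabs_pos (IZR (Z.sgn n))) as S0.
  assert (P3 : 3 < PI) by (pose proof PI2_3_2; lra).
  unfold Rdiv. rewrite Rabs_mult, (Rabs_pos_eq (/ PI)) by (left; apply Rinv_0_lt_compat; lra).
  assert (P : 0 < / PI <= 1).
  { split; [apply Rinv_0_lt_compat; lra|]. rewrite <- Rinv_1. apply Rinv_le_contravar; lra. }
  pose proof (Rabs_pos (cot_sin_primitive m eps)).
  apply Rle_lt_trans with (2 := H).
  apply Rle_trans with (2 := B).
  assert (Rabs (cot_sin_primitive m eps) * / PI <= Rabs (cot_sin_primitive m eps)) by nra.
  assert (0 <= Rabs (cot_sin_primitive m eps) * / PI) by nra.
  nra.
Qed.

(** * Termwise integration and the principal value *)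

(** Pairing k with -(k + 1) visits every integer exactly once and turns a two-sided sum into one
    ordinary series, with 0 in the first pair. *)
Definition paired {G : AbelianMonoid} (a : Z -> G) (k : nat) : G :=
  plus (a (Z.of_nat k)) (a (- Z.of_nat (S k))%Z).

Lemma is_series_paired {K : AbsRing} {V : NormedModule K} (a : Z -> V) (s : V) :
  is_bilateral_series a s -> is_series (paired a) s.
Proof. intros (s1 & s2 & H1 & H2 & ->). apply is_series_plus; assumption. Qed.

Lemma is_series_unique_NM {K : AbsRing} {V : NormedModule K} (a : nat -> V) (s t : V) :
  is_series a s -> is_series a t -> s = t.
Proof. intros Hs Ht. exact (filterlim_locally_unique (F := eventually) _ _ _ Hs Ht). Qed.

Lemma is_bilateral_series_unique {K : AbsRing} {V : NormedModule K} (a : Z -> V) (s t : V) :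
  is_bilateral_series a s -> is_bilateral_series a t -> s = t.
Proof.
  intros Hs Ht. apply is_series_unique_NM with (paired a); apply is_series_paired; assumption.
Qed.

Lemma minus_plus_l {G : AbelianGroup} (x y : G) : plus (minus x y) y = x.
Proof. unfold minus. rewrite <- plus_assoc, plus_opp_l, plus_zero_r. reflexivity. Qed.

(** The bound depends on the majorant only, hence is uniform in any parameter hidden in [a]: the
    point [y] for termwise integration, the cut-off [eps] for the principal value. *)
Lemma norm_series_tail_le {K : AbsRing} {V : NormedModule K}
    (a : nat -> V) (b : nat -> R) (l : V) (r : R) :
  (forall n, norm (a n) <= b n) -> is_series a l -> is_series b r ->
  forall N, norm (minus l (sum_n a N)) <= r - sum_n b N.
Proof.
  intros Hab Ha Hb N.
  assert (Ha' : is_series (fun k => a (S N + k)%nat) (minus l (sum_n a N))).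
  { apply is_series_incr_n with (n := S N); [lia|]. simpl pred.
    exact (eq_ind_r _ Ha (minus_plus_l (G := V) l (sum_n a N))). }
  assert (Hb' : is_series (fun k => b (S N + k)%nat) (minus r (sum_n b N))).
  { apply is_series_incr_n with (n := S N); [lia|]. simpl pred.
    exact (eq_ind_r _ Hb (minus_plus_l (G := R_NormedModule) r (sum_n b N))). }
  change (r - sum_n b N) with (minus r (sum_n b N)).
  apply (is_lim_seq_le (fun M => norm (sum_n (fun k => a (S N + k)%nat) M))
    (sum_n (fun k => b (S N + k)%nat))
    (norm (minus l (sum_n a N))) (minus r (sum_n b N))).
  - intros M. apply Rle_trans with (1 := norm_sum_n_m _ _ _).
    apply sum_n_m_le. intros k. apply Hab.
  - exact (filterlim_comp _ _ _ _ _ _ _ _ Ha' (filterlim_norm _)).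
  - exact Hb'.
Qed.

Lemma is_RInt_Cmult (z : C) (f : R -> C) (a b : R) (l : C) :
  is_RInt (V := C_R_NormedModule) f a b l ->
  is_RInt (V := C_R_NormedModule) (fun y => (z * f y)%C) a b (z * l)%C.
Proof.
  intros H.
  pose proof (is_RInt_fct_extend_fst (U := R_NormedModule) (V := R_NormedModule) _ _ _ _ H) as H1.
  pose proof (is_RInt_fct_extend_snd (U := R_NormedModule) (V := R_NormedModule) _ _ _ _ H) as H2.
  destruct z as [p q]. simpl in H1, H2.
  apply (is_RInt_fct_extend_pair (U := R_NormedModule) (V := R_NormedModule)); simpl.
  - apply (is_RInt_minus (V := R_NormedModule));
      apply (is_RInt_scal (V := R_NormedModule)); assumption.
  - apply (is_RInt_plus (V := R_NormedModule));
      apply (is_RInt_scal (V := R_NormedModule)); assumption.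
Qed.

Lemma is_RInt_paired_sum (f : Z -> R -> C) (m : Z -> C) (a b : R) :
  (forall n, is_RInt (V := C_R_NormedModule) (f n) a b (m n)) ->
  forall N, is_RInt (V := C_R_NormedModule)
    (fun y => sum_n (paired (fun n => f n y)) N) a b (sum_n (paired m) N).
Proof.
  intros H.
  assert (P : forall k, is_RInt (V := C_R_NormedModule)
    (fun y => paired (fun n => f n y) k) a b (paired m k)).
  { intros k. apply (is_RInt_plus (V := C_R_NormedModule)); apply H. }
  induction N as [|N IH].
  - rewrite sum_O. refine (is_RInt_ext (V := C_R_NormedModule) _ _ _ _ _ _ (P O)).
    intros y _. rewrite sum_O. reflexivity.
  - rewrite sum_Sn.
    refine (is_RInt_ext (V := C_R_NormedModule) _ _ _ _ _ _
      (is_RInt_plus (V := C_R_NormedModule) _ _ _ _ _ _ IH (P (S N)))).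
    intros y _. rewrite sum_Sn. reflexivity.
Qed.

Lemma is_series_small_tail (b : nat -> R) (r : R) (d : R) :
  is_series b r -> 0 < d -> eventually (fun N => r - sum_n b N < d).
Proof.
  intros Hb Hd.
  pose proof (proj1 (filterlim_locally (F := eventually) _ _) Hb (mkposreal d Hd)) as H.
  revert H. apply filter_imp. intros N H.
  change (Rabs (sum_n b N - r) < d) in H. apply Rabs_lt_between in H. lra.
Qed.

Lemma Cmod_paired_le (a : Z -> C) (b : Z -> R) :
  (forall n, Cmod (a n) <= b n) -> forall k, Cmod (paired a k) <= paired b k.
Proof.
  intros H k. apply Rle_trans with (1 := Cmod_triangle _ _).
  apply Rplus_le_compat; apply H.
Qed.

(** A bounded factor preserves the uniform convergence of the expansion, so integration is termwise.
    It serves for the cut-off kernel and, with [K] = 1, for the mean value. *)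
Lemma is_RInt_expansion (c : Z -> C) (w K : R -> C) (M a b : R) (m : Z -> C) :
  wiener_expansion c w -> (forall y, Cmod (K y) <= M) ->
  (forall n, is_RInt (V := C_R_NormedModule) (fun y => (K y * cis (IZR n * y))%C) a b (m n)) ->
  exists I : C, is_series (paired (fun n => (c n * m n)%C)) I /\
    is_RInt (V := C_R_NormedModule) (fun y => (K y * w y)%C) a b I.
Proof.
  intros [[r Hr] Hw] HK Hm.
  set (W := fun N y => sum_n (paired (fun n => (c n * (K y * cis (IZR n * y)))%C)) N).
  assert (HM : 0 <= M) by (apply Rle_trans with (2 := HK 0); apply Cmod_ge_0).
  destruct (filterlim_RInt (V := C_R_CompleteNormedModule) W a b eventually _
    (fun y => (K y * w y)%C) (sum_n (paired (fun n => (c n * m n)%C)))) as [I [H1 H2]].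
  - intros N. apply (is_RInt_paired_sum (fun n y => (c n * (K y * cis (IZR n * y)))%C)). intros n. apply is_RInt_Cmult, Hm.
  - apply filterlim_locally. intros [d Hd].
    (* [M] may be 0, hence the denominator [M + 1]. *)
    assert (Hd' : 0 < d / (M + 1)) by (apply Rdiv_lt_0_compat; lra).
    apply is_series_paired in Hr.
    generalize (is_series_small_tail _ _ _ Hr Hd'). apply filter_imp.
    intros N HN y. apply C_NormedModule_mixin_compat1. simpl.
    assert (E : W N y = (K y * sum_n (paired (fun n => (c n * cis (IZR n * y)))%C) N)%C).
    { change (W N y = mult (K y) (sum_n (paired (fun n => (c n * cis (IZR n * y)))%C) N)).
      unfold W, sum_n.
      refine (eq_trans _ (sum_n_m_mult_l (K := C_Ring) _ _ _ _)). apply sum_n_m_ext. intros k.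
      unfold paired, plus, mult; simpl. ring. }
    rewrite E.
    pose proof (norm_series_tail_le (K := C_AbsRing) (V := C_NormedModule) _ _ _ _
      (Cmod_paired_le (fun n => (c n * cis (IZR n * y))%C) (fun n => Cmod (c n))
         ltac:(intros n; cbv beta; rewrite Cmod_mult, Cmod_cis; lra))
      (is_series_paired _ _ (Hw y)) Hr N) as T.
    set (S := sum_n (paired (fun n => (c n * cis (IZR n * y)))%C) N).
    change (Cmod (w y - S) <= r - sum_n (paired (fun n => Cmod (c n))) N) in T.
    change (Cmod (K y * S - K y * w y) < d).
    replace (K y * S - K y * w y)%C with (K y * - (w y - S))%C by ring.
    rewrite Cmod_mult, Cmod_opp.
    apply Rle_lt_trans with (M * Cmod (w y - S)).
    { apply Rmult_le_compat_r; [apply Cmod_ge_0|apply HK]. }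
    apply Rle_lt_trans with (M * (d / (M + 1))).
    { apply Rmult_le_compat_l; [exact HM|]. apply Rle_trans with (1 := T). left; exact HN. }
    apply Rlt_le_trans with ((M + 1) * (d / (M + 1))).
    { apply Rmult_lt_compat_r; lra. }
    right. field. lra.
  - exists I. split; assumption.
Qed.

Lemma truncated_integrand_mult (w : R -> C) (x eps y : R) :
  truncated_integrand w x eps y = (truncated_integrand (fun _ => 1) x eps y * w y)%C.
Proof.
  unfold truncated_integrand. destruct excluded_middle_informative; ring.
Qed.

Lemma Cmod_truncated_kernel_le (x eps y : R) :
  0 < eps < PI -> Cmod (truncated_integrand (fun _ => 1) x eps y) <= / sin (eps / 2).
Proof.
  intros He.
  pose proof (sin_half_pos eps ltac:(lra)) as Hs.
  assert (Hs' : 0 < / sin (eps / 2)) by (apply Rinv_0_lt_compat, Hs).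
  unfold truncated_integrand. destruct excluded_middle_informative as [H|_].
  2:{ rewrite Cmod_0. lra. }
  rewrite Cmult_1_r, Cmod_R.
  destruct (exists_period_shift (2 * PI) (x - y) ltac:(lra)) as [k Hk].
  set (s := x - y + IZR k * (2 * PI)) in *.
  (* After the shift into one period, the multiples -k and -k + 1 are the singularities at its two
     ends 0 and 2 PI. *)
  assert (Hse : eps <= s <= 2 * PI - eps).
  { split.
    - specialize (H (- k)%Z). rewrite opp_IZR in H.
      rewrite Rabs_pos_eq in H; [|unfold s in Hk; lra]. unfold s; lra.
    - specialize (H (- k + 1)%Z). rewrite plus_IZR, opp_IZR in H.
      rewrite Rabs_left1 in H; [|unfold s in Hk; lra]. unfold s; lra. }
  replace (cot ((x - y) / 2)) with (cot (s / 2)).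
  2:{ rewrite <- (periodic_IZR cot PI cot_plus_PI k ((x - y) / 2)). f_equal. unfold s; field. }
  assert (Hss : sin (eps / 2) <= sin (s / 2)).
  { destruct (Rle_dec s PI).
    - apply sin_incr_1; lra.
    - rewrite <- (sin_PI_x (s / 2)). apply sin_incr_1; lra. }
  unfold cot, Rdiv at 1. rewrite Rabs_mult, (Rabs_pos_eq (/ _)) by (left; apply Rinv_0_lt_compat; lra).
  rewrite <- (Rmult_1_l (/ sin (eps / 2))).
  apply Rmult_le_compat; [apply Rabs_pos|left; apply Rinv_0_lt_compat; lra| |].
  - apply Rabs_le. pose proof (COS_bound (s / 2)). lra.
  - apply Rinv_le_contravar; lra.
Qed.

Lemma is_RInt_truncated_expansion (c : Z -> C) (w : R -> C) (x eps : R) :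
  wiener_expansion c w -> 0 < eps < PI ->
  exists I : C,
    is_series (paired (fun n => (c n * (truncated_symbol n eps * cis (IZR n * x)))%C)) I /\
    is_RInt (V := C_R_NormedModule) (truncated_integrand w x eps) 0 (2 * PI)
      (RtoC (2 * PI) * I)%C.
Proof.
  intros Hw He.
  destruct (is_RInt_expansion c w (truncated_integrand (fun _ => RtoC 1) x eps)
    (/ sin (eps / 2)) 0 (2 * PI)
    (fun n => RtoC (2 * PI) * (truncated_symbol n eps * cis (IZR n * x)))%C Hw)
    as [I [H1 H2]].
  - intros y. apply Cmod_truncated_kernel_le, He.
  - intros n. refine (is_RInt_ext (V := C_R_NormedModule) _ _ _ _ _ _ (is_RInt_truncated_cis n x eps He)).
    intros y _. apply (truncated_integrand_mult (fun y => cis (IZR n * y))).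
  - assert (Hp : RtoC (2 * PI) <> RtoC 0).
    { intros E. apply RtoC_inj in E. pose proof PI_RGT_0. lra. }
    exists (/ RtoC (2 * PI) * I)%C. split.
    + apply (is_series_ext (V := C_NormedModule) (fun k => scal (/ RtoC (2 * PI))%C
        (paired (fun n => (c n * (RtoC (2 * PI) * (truncated_symbol n eps * cis (IZR n * x)))))%C k))).
      { intros k. unfold paired, scal, plus; simpl; unfold mult; simpl. field. exact Hp. }
      apply (is_series_scal (V := C_NormedModule)). exact H1.
    + replace (RtoC (2 * PI) * (/ RtoC (2 * PI) * I))%C with I by (field; exact Hp).
      refine (is_RInt_ext (V := C_R_NormedModule) _ _ _ _ _ _ H2).
      intros y _. symmetry; apply truncated_integrand_mult.
Qed.

Lemma Cmod_hilbert_symbol_le (n : Z) : Cmod (hilbert_symbol n) <= 1.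
Proof.
  unfold hilbert_symbol. rewrite Cmod_mult, Cmod_opp, Cmod_Ci, Rmult_1_l, Cmod_R.
  apply Rabs_IZR_sgn_le.
Qed.

Lemma filterlim_paired_sum {T : Type} (F : (T -> Prop) -> Prop) {FF : Filter F}
    (f : Z -> T -> C) (g : Z -> C) :
  (forall n, filterlim (f n) F (locally (T := C_NormedModule) (g n))) ->
  forall N, filterlim (fun t => sum_n (paired (fun n => f n t)) N) F
    (locally (T := C_NormedModule) (sum_n (paired g) N)).
Proof.
  intros H.
  assert (P : forall k, filterlim (fun t => paired (fun n => f n t) k) F
    (locally (T := C_NormedModule) (paired g k))).
  { intros k. refine (filterlim_comp_2 _ _ _ (H _) (H _) _).
    apply (filterlim_plus (V := C_NormedModule)). }
  induction N as [|N IH].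
  - rewrite sum_O. refine (filterlim_ext _ _ _ (P O)). intros t. rewrite sum_O; reflexivity.
  - rewrite sum_Sn.
    refine (filterlim_ext (fun t => plus (sum_n (paired (fun n => f n t)) N)
       (paired (fun n => f n t) (S N))) _ _ _).
    { intros t. rewrite sum_Sn. reflexivity. }
    refine (filterlim_comp_2 _ _ _ IH (P (S N)) _).
    apply (filterlim_plus (V := C_NormedModule)).
Qed.

Lemma is_hilbert_expansion (c : Z -> C) (w : R -> C) (x : R) (l : C) :
  wiener_expansion c w ->
  is_bilateral_series (fun n => (hilbert_symbol n * c n * cis (IZR n * x))%C) l ->
  is_hilbert w x l.
Proof.
  intros Hw Hl.
  pose proof Hw as [[r Hr] _].
  apply is_series_paired in Hr. apply is_series_paired in Hl.
  set (b := paired (fun n => Cmod (c n))) in *.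
  assert (Hb : is_series (fun k => scal 3 (b k)) (scal 3 r)).
  { apply (is_series_scal (V := R_NormedModule)), Hr. }
  assert (Hb' : forall a : Z -> C, (forall n, Cmod (a n) <= 3 * Cmod (c n)) ->
    forall k, Cmod (paired a k) <= scal 3 (b k)).
  { intros a Ha k. apply Rle_trans with (1 := Cmod_paired_le _ _ Ha k).
    right. unfold b, paired, plus, scal; simpl; unfold mult; simpl. ring. }
  apply (proj2 (filterlimi_locally _ _)). intros [d Hd].
  (* [N] is fixed before [eps]: the majorant 3 |c_n| serves the truncated and the limit series
     alike, so both tails are below d/3 for every small [eps]. The finitely many remaining terms
     contribute the last third. *)
  destruct (filter_ex (F := eventually) _ (is_series_small_tail _ _ (d / 3) Hb ltac:(lra))) as [N HN].
  set (q := fun n eps => (c n * (truncated_symbol n eps * cis (IZR n * x)))%C).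
  assert (L : filterlim (fun eps => sum_n (paired (fun n => q n eps)) N) (at_right 0)
    (locally (T := C_NormedModule) (sum_n (paired
      (fun n => (hilbert_symbol n * c n * cis (IZR n * x))%C)) N))).
  { apply (filterlim_paired_sum (at_right 0) q). intros n.
    replace (hilbert_symbol n * c n * cis (IZR n * x))%C with
      (scal (c n * cis (IZR n * x))%C (hilbert_symbol n : C_NormedModule))
      by (unfold scal; simpl; unfold mult; simpl; ring).
    apply (filterlim_ext (fun eps => scal (c n * cis (IZR n * x))%C (truncated_symbol n eps : C_NormedModule))).
    { intros eps. unfold q, scal; simpl; unfold mult; simpl. ring. }
    refine (filterlim_comp _ _ _ _ _ _ _ _ (truncated_symbol_limit n) _).
    apply (filterlim_scal_r (V := C_NormedModule)). }
  assert (Hd3 : 0 < d / 3) by lra.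
  specialize (L _ (locally_le_locally_norm (V := C_NormedModule) _ _
    (locally_norm_ball_norm (V := C_NormedModule) _ (mkposreal _ Hd3)))).
  assert (Hpi : 0 < PI) by apply PI_RGT_0.
  assert (E : at_right 0 (fun eps => 0 < eps < PI)).
  { exists (mkposreal _ Hpi). intros eps Hball Hpos.
    change (Rabs (eps - 0) < PI) in Hball. apply Rabs_lt_between in Hball. lra. }
  generalize (filter_and _ _ E L). apply filter_imp. clear L E. intros eps [He L].
  destruct (is_RInt_truncated_expansion c w x eps Hw He) as [I [HI HR]].
  exists I. split.
  { exists (RtoC (2 * PI) * I)%C. split; [exact HR|].
    rewrite RtoC_inv by lra. field. intros E. apply RtoC_inj in E. lra. }
  apply C_NormedModule_mixin_compat1. change (Cmod (I - l) < d).
  unfold ball_norm in L. cbv beta in L. simpl pos in L.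
  assert (B1 : forall n, Cmod (q n eps) <= 3 * Cmod (c n)).
  { intros n. unfold q. rewrite !Cmod_mult, Cmod_cis.
    pose proof (Cmod_truncated_symbol_le n eps He). pose proof (Cmod_ge_0 (c n)). nra. }
  assert (B2 : forall n, Cmod (hilbert_symbol n * c n * cis (IZR n * x)) <= 3 * Cmod (c n)).
  { intros n. rewrite !Cmod_mult, Cmod_cis.
    pose proof (Cmod_hilbert_symbol_le n). pose proof (Cmod_ge_0 (c n)). nra. }
  pose proof (norm_series_tail_le (V := C_NormedModule) _ _ _ _
    (Hb' (fun n => q n eps) B1) HI Hb N) as T1.
  pose proof (norm_series_tail_le (V := C_NormedModule) _ _ _ _
    (Hb' (fun n => (hilbert_symbol n * c n * cis (IZR n * x))%C) B2) Hl Hb N) as T2.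
  set (A1 := sum_n (paired (fun n => q n eps)) N) in *.
  set (A2 := sum_n (paired (fun n => (hilbert_symbol n * c n * cis (IZR n * x))%C)) N) in *.
  change (Cmod (A1 - A2) < d / 3) in L.
  change (Cmod (I - A1) <= scal 3 r - sum_n (fun k => scal 3 (b k)) N) in T1.
  change (Cmod (l - A2) <= scal 3 r - sum_n (fun k => scal 3 (b k)) N) in T2.
  replace (I - l)%C with ((I - A1) + ((A1 - A2) + - (l - A2)))%C by ring.
  apply Rle_lt_trans with (1 := Cmod_triangle _ _).
  pose proof (Cmod_triangle (A1 - A2) (- (l - A2))) as T3. rewrite Cmod_opp in T3.
  pose proof (Rle_lt_trans _ _ _ T1 HN) as U1.
  pose proof (Rle_lt_trans _ _ _ T2 HN) as U2.
  lra.
Qed.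

(** The relation under the limit is functional, because an integral has only one value; hence [iota]
    picks the limit. *)
Lemma hilbert_unique (w : R -> C) (x : R) (l : C) :
  is_hilbert w x l -> hilbert w x = l.
Proof.
  intros H. unfold hilbert.
  apply (iota_filterlimi_locally (V := C_CompleteNormedModule)
    (F := at_right 0) _ l); [|exact H].
  apply filter_forall. intros eps z1 z2 (I1 & H1 & ->) (I2 & H2 & ->).
  apply (is_RInt_unique (V := C_R_CompleteNormedModule)) in H1.
  apply (is_RInt_unique (V := C_R_CompleteNormedModule)) in H2.
  congruence.
Qed.

(** * The multiplier on coefficients *)

Lemma is_bilateral_series_ext {K : AbsRing} {V : NormedModule K} (a b : Z -> V) (s : V) :
  (forall n, a n = b n) -> is_bilateral_series a s -> is_bilateral_series b s.
Proof.
  intros E (s1 & s2 & H1 & H2 & Hs). exists s1, s2.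
  split; [|split; [|exact Hs]].
  - exact (is_series_ext _ _ _ (fun n => E _) H1).
  - exact (is_series_ext _ _ _ (fun n => E _) H2).
Qed.

Lemma is_bilateral_series_plus {K : AbsRing} {V : NormedModule K} (a b : Z -> V) (s t : V) :
  is_bilateral_series a s -> is_bilateral_series b t ->
  is_bilateral_series (fun n => plus (a n) (b n)) (plus s t).
Proof.
  intros (s1 & s2 & H1 & H2 & ->) (t1 & t2 & G1 & G2 & ->).
  exists (plus s1 t1), (plus s2 t2). split; [|split].
  - exact (is_series_plus _ _ _ _ H1 G1).
  - exact (is_series_plus _ _ _ _ H2 G2).
  - rewrite <- !plus_assoc. f_equal. rewrite !plus_assoc. f_equal. apply plus_comm.
Qed.

Lemma is_bilateral_series_scal {K : AbsRing} {V : NormedModule K} (k : K) (a : Z -> V) (s : V) :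
  is_bilateral_series a s -> is_bilateral_series (fun n => scal k (a n)) (scal k s).
Proof.
  intros (s1 & s2 & H1 & H2 & ->). exists (scal k s1), (scal k s2). split; [|split].
  - exact (is_series_scal k _ _ H1).
  - exact (is_series_scal k _ _ H2).
  - apply @scal_distr_l.
Qed.

Lemma ex_bilateral_series_le {K : AbsRing} {V : CompleteNormedModule K}
    (a : Z -> V) (b : Z -> R) (r : R) :
  (forall n, norm (a n) <= b n) -> is_bilateral_series b r ->
  exists s : V, is_bilateral_series a s.
Proof.
  intros Hab (r1 & r2 & H1 & H2 & _).
  destruct (ex_series_le (fun n : nat => a (Z.of_nat n)) (fun n : nat => b (Z.of_nat n)))
    as [s1 G1]; [intros n; apply Hab | exists r1; exact H1 |].
  destruct (ex_series_le (fun n : nat => a (- Z.of_nat (S n))%Z) (fun n : nat => b (- Z.of_nat (S n))%Z))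
    as [s2 G2]; [intros n; apply Hab | exists r2; exact H2 |].
  exists (plus s1 s2), s1, s2. auto.
Qed.

Lemma wiener_expansion_ext (c d : Z -> C) (u v : R -> C) :
  (forall n, c n = d n) -> (forall x, u x = v x) ->
  wiener_expansion c u -> wiener_expansion d v.
Proof.
  intros Hcd Huv [[r Hr] Hu]. split.
  - exists r. refine (is_bilateral_series_ext _ _ _ _ Hr). intros n. f_equal. apply Hcd.
  - intros x. rewrite <- Huv. refine (is_bilateral_series_ext _ _ _ _ (Hu x)).
    intros n. rewrite Hcd. reflexivity.
Qed.

(** Coefficients determine the function. Identities between operators are checked on coefficients
    and carried over to functions by this lemma. *)
Lemma wiener_expansion_unique (c : Z -> C) (u v : R -> C) :
  wiener_expansion c u -> wiener_expansion c v -> forall x, u x = v x.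
Proof.
  intros [_ Hu] [_ Hv] x. exact (is_bilateral_series_unique _ _ _ (Hu x) (Hv x)).
Qed.

Lemma wiener_expansion_lin (a b : C) (c d : Z -> C) (u v : R -> C) :
  wiener_expansion c u -> wiener_expansion d v ->
  wiener_expansion (fun n => a * c n + b * d n)%C (fun x => a * u x + b * v x)%C.
Proof.
  intros [[r Hr] Hu] [[s Hs] Hv]. split.
  - pose proof (is_bilateral_series_plus (V := R_NormedModule) _ _ _ _
      (is_bilateral_series_scal (V := R_NormedModule) (Cmod a) _ _ Hr)
      (is_bilateral_series_scal (V := R_NormedModule) (Cmod b) _ _ Hs)) as H.
    refine (ex_bilateral_series_le (V := R_CompleteNormedModule) _ _ _ _ H).
    intros n. change (Rabs (Cmod (a * c n + b * d n)) <= Cmod a * Cmod (c n) + Cmod b * Cmod (d n)).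
    rewrite Rabs_pos_eq by apply Cmod_ge_0. rewrite <- !Cmod_mult. apply Cmod_triangle.
  - intros x.
    refine (is_bilateral_series_ext _ _ _ _ (is_bilateral_series_plus (V := C_NormedModule) _ _ _ _
      (is_bilateral_series_scal (V := C_NormedModule) a _ _ (Hu x))
      (is_bilateral_series_scal (V := C_NormedModule) b _ _ (Hv x)))).
    intros n. unfold plus, scal; simpl; unfold mult; simpl. ring.
Qed.

Lemma wiener_expansion_periodic (c : Z -> C) (w : R -> C) :
  wiener_expansion c w -> forall x, w (x + 2 * PI) = w x.
Proof.
  intros [_ Hw] x.
  refine (is_bilateral_series_unique (V := C_NormedModule) _ _ _ (Hw (x + 2 * PI)) _).
  refine (is_bilateral_series_ext _ _ _ _ (Hw x)).
  intros n. rewrite cis_IZR_period. reflexivity.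
Qed.

Lemma hilbert_expansion (c : Z -> C) (w : R -> C) :
  wiener_expansion c w ->
  hilbert_defined w /\ wiener_expansion (fun n => hilbert_symbol n * c n)%C (hilbert w).
Proof.
  intros Hw. pose proof Hw as [[r Hr] _].
  assert (B : forall n, Cmod (hilbert_symbol n * c n) <= Cmod (c n)).
  { intros n. rewrite Cmod_mult.
    pose proof (Cmod_hilbert_symbol_le n). pose proof (Cmod_ge_0 (c n)). nra. }
  assert (E : forall x, exists l : C,
    is_bilateral_series (fun n => (hilbert_symbol n * c n * cis (IZR n * x))%C) l).
  { intros x. refine (ex_bilateral_series_le (V := C_CompleteNormedModule) _ _ _ _ Hr).
    intros n. change (Cmod (hilbert_symbol n * c n * cis (IZR n * x)) <= Cmod (c n)).
    rewrite Cmod_mult, Cmod_cis, Rmult_1_r. apply B. }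
  repeat split.
  - intros x. destruct (E x) as [l Hl]. exists l.
    exact (is_hilbert_expansion _ _ _ _ Hw Hl).
  - refine (ex_bilateral_series_le (V := R_CompleteNormedModule) _ _ _ _ Hr).
    intros n. change (Rabs (Cmod (hilbert_symbol n * c n)) <= Cmod (c n)).
    rewrite Rabs_pos_eq by apply Cmod_ge_0. apply B.
  - intros x. destruct (E x) as [l Hl].
    rewrite (hilbert_unique _ _ _ (is_hilbert_expansion _ _ _ _ Hw Hl)). exact Hl.
Qed.

Lemma hilbert_symbol_pos (n : Z) : (0 < n)%Z -> hilbert_symbol n = (- Ci)%C.
Proof. intros H. unfold hilbert_symbol. rewrite Z.sgn_pos by exact H. ring. Qed.

Lemma hilbert_symbol_neg (n : Z) : (n < 0)%Z -> hilbert_symbol n = Ci.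
Proof.
  intros H. unfold hilbert_symbol. rewrite Z.sgn_neg by exact H.
  change (IZR (-1)) with (- (1)). rewrite RtoC_opp. ring.
Qed.

Lemma Ci_sqr : (Ci * Ci)%C = (- RtoC 1)%C.
Proof. unfold Ci, Cmult, Copp, RtoC; simpl. f_equal; ring. Qed.

(** The symbol is 0 at n = 0, so there the identity holds only for z = 0; this is where mean zero
    enters. *)
Lemma hilbert_symbol_sqr (n : Z) (z : C) :
  (n = 0%Z -> z = RtoC 0) -> (hilbert_symbol n * (hilbert_symbol n * z))%C = (- z)%C.
Proof.
  intros Hz. destruct (Z.lt_trichotomy n 0) as [H|[H|H]].
  - rewrite hilbert_symbol_neg by exact H. rewrite Cmult_assoc, Ci_sqr. ring.
  - rewrite (Hz H). ring.
  - rewrite hilbert_symbol_pos by exact H.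
    transitivity (Ci * Ci * z)%C; [ring|]. rewrite Ci_sqr. ring.
Qed.

(** * The mean value determines the coefficient of index 0 *)

Lemma is_RInt_cis (n : Z) :
  is_RInt (V := C_R_NormedModule) (fun y => cis (IZR n * y)) 0 (2 * PI)
    (if Z.eq_dec n 0 then RtoC (2 * PI) else RtoC 0).
Proof.
  destruct (Z.eq_dec n 0) as [->|Hn].
  - pose proof (is_RInt_const (V := C_R_NormedModule) 0 (2 * PI) (RtoC 1)) as H.
    replace (RtoC (2 * PI)) with (scal (V := C_R_NormedModule) (2 * PI - 0) (RtoC 1)).
    + refine (is_RInt_ext (V := C_R_NormedModule) _ _ _ _ _ _ H).
      intros y _. rewrite Rmult_0_l. unfold cis. rewrite cos_0, sin_0. reflexivity.
    + apply injective_projections; unfold scal; simpl; unfold scal; simpl; unfold mult; simpl; ring.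
  - assert (Hn' : IZR n <> 0) by (apply not_0_IZR, Hn).
    pose proof (cis_IZR_period n 0) as P. rewrite Rmult_0_r, Rplus_0_l in P.
    unfold cis in P. injection P as Pc Ps.
    apply (is_RInt_fct_extend_pair (U := R_NormedModule) (V := R_NormedModule)); simpl.
    + replace 0 with (minus (sin (IZR n * (2 * PI)) / IZR n) (sin (IZR n * 0) / IZR n)) at 2.
      * apply (is_RInt_derive (V := R_CompleteNormedModule) (fun y => sin (IZR n * y) / IZR n)).
        -- intros y _. auto_derive; [easy|]. field. exact Hn'.
        -- intros y _. apply @ex_derive_continuous. auto_derive; easy.
      * rewrite Ps, Rmult_0_r. unfold minus. apply (plus_opp_r (G := R_AbelianGroup)).
    + replace 0 with (minus (- cos (IZR n * (2 * PI)) / IZR n) (- cos (IZR n * 0) / IZR n)) at 2.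
      * apply (is_RInt_derive (V := R_CompleteNormedModule) (fun y => - cos (IZR n * y) / IZR n)).
        -- intros y _. auto_derive; [easy|]. field. exact Hn'.
        -- intros y _. apply @ex_derive_continuous. auto_derive; easy.
      * rewrite Pc, Rmult_0_r. unfold minus. apply (plus_opp_r (G := R_AbelianGroup)).
Qed.

Lemma is_RInt_wiener_expansion (c : Z -> C) (w : R -> C) :
  wiener_expansion c w ->
  is_RInt (V := C_R_NormedModule) w 0 (2 * PI) (c 0%Z * RtoC (2 * PI))%C.
Proof.
  intros Hw.
  destruct (is_RInt_expansion c w (fun _ => RtoC 1) 1 0 (2 * PI)
    (fun n => if Z.eq_dec n 0 then RtoC (2 * PI) else RtoC 0) Hw) as [I [H1 H2]].
  - intros _. rewrite Cmod_1. lra.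
  - intros n. refine (is_RInt_ext (V := C_R_NormedModule) _ _ _ _ _ _ (is_RInt_cis n)).
    intros y _. symmetry; apply Cmult_1_l.
  - replace (c 0%Z * RtoC (2 * PI))%C with I.
    { refine (is_RInt_ext (V := C_R_NormedModule) _ _ _ _ _ _ H2).
      intros y _. apply Cmult_1_l. }
    set (a := paired _) in H1.
    (* Index 0 sits in the first pair and every other harmonic integrates to 0, so the partial sums
       are constant. *)
    assert (E : forall N, @eq C (sum_n a N) (c 0%Z * RtoC (2 * PI))%C).
    { induction N as [|N IH].
      - rewrite sum_O. unfold a, paired, plus; simpl. ring.
      - rewrite sum_Sn, IH. unfold a, paired.
        destruct (Z.eq_dec (Z.of_nat (S N)) 0) as [?|_]; [lia|].
        destruct (Z.eq_dec (- Z.of_nat (S (S N))) 0) as [?|_]; [lia|].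
        unfold plus; simpl. ring. }
    apply (filterlim_locally_unique (F := eventually) (V := C_NormedModule) (sum_n a)); [exact H1|].
    apply (filterlim_ext (fun _ => (c 0%Z * RtoC (2 * PI))%C)).
    + intros N. symmetry; apply E.
    + apply filterlim_const.
Qed.

Lemma wiener_expansion_mean_unique (c d : Z -> C) (w : R -> C) :
  wiener_expansion c w -> wiener_expansion d w -> c 0%Z = d 0%Z.
Proof.
  intros Hc Hd.
  apply is_RInt_wiener_expansion in Hc. apply is_RInt_wiener_expansion in Hd.
  apply (is_RInt_unique (V := C_R_CompleteNormedModule)) in Hc.
  apply (is_RInt_unique (V := C_R_CompleteNormedModule)) in Hd.
  rewrite Hc in Hd.
  assert (Hp : RtoC (2 * PI) <> RtoC 0).
  { intros E. apply RtoC_inj in E. pose proof PI_RGT_0. lra. }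
  apply (f_equal (fun z => (z / RtoC (2 * PI))%C)) in Hd.
  unfold Cdiv in Hd. rewrite <- !Cmult_assoc, Cinv_r, !Cmult_1_r in Hd by exact Hp. exact Hd.
Qed.

(** * The Hilbert operator on mean-zero functions *)

(** [wiener0] provides one expansion with vanishing mean, while [wiener_norm] ranges over all
    expansions; this passes from one to all. *)
Lemma wiener0_expansion (c : Z -> C) (w : R -> C) :
  wiener0 w -> wiener_expansion c w -> c 0%Z = RtoC 0.
Proof.
  intros (d & Hd & Hd0) Hc. rewrite <- Hd0. exact (wiener_expansion_mean_unique _ _ _ Hc Hd).
Qed.

Lemma wiener0_hilbert (w : R -> C) : wiener0 w -> wiener0 (hilbert w).
Proof.
  intros (c & Hc & Hc0). eexists. split; [exact (proj2 (hilbert_expansion _ _ Hc))|].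
  cbv beta. rewrite Hc0. ring.
Qed.

Lemma hilbert_hilbert (w : R -> C) :
  wiener0 w -> forall x, hilbert (hilbert w) x = (- w x)%C.
Proof.
  intros (c & Hc & Hc0).
  pose proof (proj2 (hilbert_expansion _ _ (proj2 (hilbert_expansion _ _ Hc)))) as H1.
  (* A scalar multiple is encoded as a linear combination whose second coefficient is 0. *)
  pose proof (wiener_expansion_lin (- RtoC 1) 0 _ _ _ _ Hc Hc) as H2.
  apply (wiener_expansion_unique _ _ _ H1).
  refine (wiener_expansion_ext _ _ _ _ _ _ H2).
  - intros n. rewrite hilbert_symbol_sqr; [ring|]. intros ->; exact Hc0.
  - intros x; ring.
Qed.

Lemma hilbert_lin (a b : C) (u v : R -> C) (x : R) :
  wiener u -> wiener v ->
  hilbert (fun y => (a * u y + b * v y)%C) x = (a * hilbert u x + b * hilbert v x)%C.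
Proof.
  intros [c Hc] [d Hd]. revert x.
  pose proof (proj2 (hilbert_expansion _ _ (wiener_expansion_lin a b _ _ _ _ Hc Hd))) as H1.
  pose proof (wiener_expansion_lin a b _ _ _ _
    (proj2 (hilbert_expansion _ _ Hc)) (proj2 (hilbert_expansion _ _ Hd))) as H2.
  apply (wiener_expansion_unique _ _ _ H1).
  refine (wiener_expansion_ext _ _ _ _ _ _ H2); [|reflexivity].
  intros n; cbv beta; ring.
Qed.

Lemma hilbert_expansion_norm (c : Z -> C) (w : R -> C) (r : R) :
  wiener0 w -> wiener_expansion c w ->
  is_bilateral_series (fun n => Cmod (c n)) r ->
  is_bilateral_series (fun n => Cmod (hilbert_symbol n * c n)) r.
Proof.
  intros H0 Hc. apply is_bilateral_series_ext. intros n.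
  pose proof (wiener0_expansion _ _ H0 Hc) as Hc0.
  rewrite Cmod_mult. destruct (Z.lt_trichotomy n 0) as [H|[->|H]].
  - rewrite hilbert_symbol_neg, Cmod_Ci by exact H. symmetry. apply Rmult_1_l.
  - rewrite Hc0, Cmod_0. symmetry. apply Rmult_0_r.
  - rewrite hilbert_symbol_pos, Cmod_opp, Cmod_Ci by exact H. symmetry. apply Rmult_1_l.
Qed.

(** The two [iota] predicates are equivalent: the values of the coefficient sum attained by
    expansions of [w] and of [hilbert w] are the same. *)
Lemma wiener_norm_hilbert (w : R -> C) :
  wiener0 w -> wiener_norm (hilbert w) = wiener_norm w.
Proof.
  intros Hw. unfold wiener_norm. apply (eq_close (K := R_AbsRing) (V := R_NormedModule)), @close_iota.
  intros r. split.
  - intros (d & Hd & Hr).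
    (* An expansion of H w is turned into one of w by applying - H, which inverts H on mean-zero
       functions. *)
    exists (fun n => - RtoC 1 * (hilbert_symbol n * d n) + 0 * d n)%C. split.
    + refine (wiener_expansion_ext _ _ _ _ _ _ (wiener_expansion_lin (- RtoC 1) 0 _ _ _ _
        (proj2 (hilbert_expansion _ _ Hd)) Hd)); [reflexivity|].
      intros x. rewrite hilbert_hilbert by exact Hw. ring.
    + refine (is_bilateral_series_ext _ _ _ _
        (hilbert_expansion_norm _ _ _ (wiener0_hilbert _ Hw) Hd Hr)).
      intros n. rewrite <- Cmod_opp. f_equal. ring.
  - intros (c & Hc & Hr). eexists. split.
    + exact (proj2 (hilbert_expansion _ _ Hc)).
    + exact (hilbert_expansion_norm _ _ _ Hw Hc Hr).
Qed.

(** The symbol is constant on each side of 0, which gives the eigenvalue i on negative and - i on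
    positive indices; at index 0 both sides vanish because of [c 0] = 0. *)
Lemma one_sided_eigenfunction (c : Z -> C) (w : R -> C) :
  wiener_expansion c w -> c 0%Z = RtoC 0 ->
  (forall n : Z, (0 < n)%Z -> c n = RtoC 0) \/
  (forall n : Z, (n < 0)%Z -> c n = RtoC 0) ->
  eigenfunction w.
Proof.
  intros Hc Hc0 Hside. split; [exact (wiener_expansion_periodic _ _ Hc)|].
  destruct (hilbert_expansion _ _ Hc) as [Hdef Hh]. split; [exact Hdef|].
  assert (E : exists lambda : C, forall n, (hilbert_symbol n * c n)%C = (lambda * c n)%C).
  { destruct Hside as [H|H].
    - exists Ci. intros n. destruct (Z.lt_trichotomy n 0) as [Hn|[->|Hn]].
      + rewrite hilbert_symbol_neg by exact Hn. reflexivity.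
      + rewrite Hc0. ring.
      + rewrite H by exact Hn. ring.
    - exists (- Ci)%C. intros n. destruct (Z.lt_trichotomy n 0) as [Hn|[->|Hn]].
      + rewrite H by exact Hn. ring.
      + rewrite Hc0. ring.
      + rewrite hilbert_symbol_pos by exact Hn. reflexivity. }
  destruct E as [lambda E]. exists lambda.
  apply (wiener_expansion_unique _ _ _ Hh).
  refine (wiener_expansion_ext _ _ _ _ _ _ (wiener_expansion_lin lambda 0 _ _ _ _ Hc Hc)).
  - intros n. rewrite E. ring.
  - intros x; ring.
Qed.

(* [(w + e i H w) / 2] keeps the coefficients whose index has the sign [e] and
   kills the others. *)
Lemma half_eigenfunction (w : R -> C) (e : R) :
  wiener0 w -> e = 1 \/ e = -1 ->
  let u := fun x => (RtoC (/ 2) * w x + RtoC (e / 2) * Ci * hilbert w x)%C in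
  wiener0 u /\ eigenfunction u.
Proof.
  intros (c & Hc & Hc0) He u.
  pose proof (wiener_expansion_lin (RtoC (/ 2)) (RtoC (e / 2) * Ci)%C _ _ _ _ Hc
    (proj2 (hilbert_expansion _ _ Hc))) as Hu. fold u in Hu.
  assert (Hu0 : (RtoC (/ 2) * c 0%Z + RtoC (e / 2) * Ci * (hilbert_symbol 0 * c 0%Z))%C = RtoC 0).
  { rewrite Hc0. ring. }
  split; [exists (fun n => (RtoC (/ 2) * c n + RtoC (e / 2) * Ci * (hilbert_symbol n * c n))%C); split; assumption|].
  apply (one_sided_eigenfunction _ _ Hu Hu0).
  destruct He as [-> | ->]; [right|left]; intros n Hn.
  - rewrite hilbert_symbol_neg by exact Hn.
    replace (RtoC (1 / 2)) with (RtoC (/ 2)) by (f_equal; field).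
    transitivity (RtoC (/ 2) * c n * (1 + Ci * Ci))%C; [ring|]. rewrite Ci_sqr. ring.
  - rewrite hilbert_symbol_pos by exact Hn.
    replace (RtoC (-1 / 2)) with (- RtoC (/ 2))%C by (rewrite <- RtoC_opp; f_equal; field).
    transitivity (RtoC (/ 2) * c n * (1 + Ci * Ci))%C; [ring|]. rewrite Ci_sqr. ring.
Qed.

Lemma wiener0_wiener (w : R -> C) : wiener0 w -> wiener w.
Proof. intros (c & Hc & _). exists c. exact Hc. Qed.

Theorem mainTheorem11 :
  (* H maps W_0 onto itself *)
  ((forall w : R -> C, wiener0 w ->
      hilbert_defined w /\ wiener0 (hilbert w)) /\
   (forall v : R -> C, wiener0 v ->
      exists w : R -> C, wiener0 w /\ forall x : R, hilbert w x = v x)) /\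
  (* H is an isometric (linear) operator on W_0 *)
  ((forall (a b : C) (u v : R -> C), wiener0 u -> wiener0 v ->
      forall x : R,
        hilbert (fun y : R => (a * u y + b * v y)%C) x =
        (a * hilbert u x + b * hilbert v x)%C) /\
   (forall w : R -> C, wiener0 w ->
      wiener_norm (hilbert w) = wiener_norm w)) /\
  (* one-sided expansions are eigenfunctions *)
  (forall (c : Z -> C) (w : R -> C),
      wiener_expansion c w -> c 0%Z = RtoC 0 ->
      (forall n : Z, (0 < n)%Z -> c n = RtoC 0) \/
      (forall n : Z, (n < 0)%Z -> c n = RtoC 0) ->
      eigenfunction w) /\
  (* decomposition into two eigenfunctions *)
  (forall w : R -> C, wiener0 w ->
      exists u v : R -> C,
        wiener0 u /\ eigenfunction u /\
        wiener0 v /\ eigenfunction v /\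
        forall x : R, w x = (u x + v x)%C).
Proof.
  split; [split|split; [split|split]].
  - intros w Hw. split; [|exact (wiener0_hilbert _ Hw)].
    destruct Hw as (c & Hc & _). exact (proj1 (hilbert_expansion _ _ Hc)).
  (* The preimage is - H v. *)
  - intros v Hv. exists (fun y => - RtoC 1 * hilbert v y + 0 * hilbert v y)%C.
    pose proof (wiener0_hilbert _ Hv) as Hv'. split.
    + destruct Hv' as (c & Hc & Hc0). eexists. split.
      * exact (wiener_expansion_lin _ _ _ _ _ _ Hc Hc).
      * cbv beta. rewrite Hc0. ring.
    + intros x. rewrite hilbert_lin by (apply wiener0_wiener; exact Hv').
      rewrite hilbert_hilbert by exact Hv. ring.
  - intros a b u v Hu Hv x. apply hilbert_lin; apply wiener0_wiener; assumption.
  - exact wiener_norm_hilbert.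
  - exact one_sided_eigenfunction.
  - intros w Hw.
    (* The signs 1 and -1 give the positive-index and negative-index halves of w; their i H w parts
       cancel in the sum. *)
    destruct (half_eigenfunction w 1 Hw (or_introl eq_refl)) as [U1 U2].
    destruct (half_eigenfunction w (-1) Hw (or_intror eq_refl)) as [V1 V2].
    eexists; eexists. split; [exact U1|split; [exact U2|split; [exact V1|split; [exact V2|]]]].
    intros x. cbv beta.
    replace (RtoC (-1 / 2)) with (- RtoC (1 / 2))%C by (rewrite <- RtoC_opp; f_equal; field).
    transitivity ((RtoC (/ 2) + RtoC (/ 2)) * w x)%C; [|ring].
    rewrite <- RtoC_plus. replace (/ 2 + / 2) with 1 by field. ring.
Qed.
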